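(* Let $n\ge 2$ and let $M=\{(p,q)\mid p\in\mathbb{Q},\ p\ge 0,\ q\in\mathbb{Z},\ p=0\Rightarrow q\in\mathbb{N}\}$ with componentwise addition $(p,q)+(p',q')=(p+p',q+q')$. Then there is no function $V:M\to M$ such that $(M;=,+,V)$ is a model of $\mathrm{BA}_n$ (with $V$ interpreting $V_n$).
   Context: $\mathrm{BA}_n=\mathrm{Th}(\mathbb{N};=,+,V_n)$, where $V_n(x)$ is the largest power of $n$ dividing $x$ for $x\neq 0$ and $V_n(0)=0$. (The structure $(M;=,+)$ is a non-standard model of Presburger arithmetic $\mathrm{Th}(\mathbb{N};=,+)$.) *)

(* Defs.v *)
From HB Require Import structures.
From mathcomp Require Import all_boot all_order all_algebra.
Set Implicit Arguments.
Unset Strict Implicit.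
Unset Printing Implicit Defensive.
Import Order.TTheory GRing.Theory Num.Theory.

(* First-order logic with equality over the signature with a binary function
   symbol + and a unary function symbol V; variables are named by naturals. *)
Inductive term : Type :=
  | Var of nat
  | Add of term & term
  | AppV of term.

Inductive formula : Type :=
  | Eq of term & term
  | Bot
  | Not of formula
  | And of formula & formula
  | Or of formula & formula
  | Imp of formula & formula
  | All of nat & formula
  | Ex of nat & formula.

Fixpoint term_vars (t : term) : seq nat :=
  match t with
  | Var i => [:: i]
  | Add s t => term_vars s ++ term_vars t
  | AppV t => term_vars t
  end.

Fixpoint free_vars (f : formula) : seq nat :=
  match f with
  | Eq s t => term_vars s ++ term_vars t
  | Bot => [::]
  | Not g => free_vars g
  | And g h | Or g h | Imp g h => free_vars g ++ free_vars h
  | All i g | Ex i g => [seq j <- free_vars g | j != i]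
  end.

Definition sentence (f : formula) : Prop := free_vars f = [::].

(* Equality is not part of the data: it is always interpreted as identity. *)
Record structure : Type := Structure {
  carrier : Type;
  add_op : carrier -> carrier -> carrier;
  V_op : carrier -> carrier
}.

Fixpoint eval (S : structure) (e : nat -> carrier S) (t : term) : carrier S :=
  match t with
  | Var i => e i
  | Add s t => add_op (eval e s) (eval e t)
  | AppV t => V_op (eval e t)
  end.

Definition update (T : Type) (e : nat -> T) (i : nat) (a : T) : nat -> T :=
  fun j => if j == i then a else e j.

Fixpoint holds (S : structure) (e : nat -> carrier S) (f : formula) : Prop :=
  match f with
  | Eq s t => eval e s = eval e t
  | Bot => False
  | Not g => ~ holds e g
  | And g h => holds e g /\ holds e h
  | Or g h => holds e g \/ holds e h
  | Imp g h => holds e g -> holds e h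
  | All i g => forall a : carrier S, holds (update e i a) g
  | Ex i g => exists a : carrier S, holds (update e i a) g
  end.

Definition satisfies (S : structure) (f : formula) : Prop :=
  forall e : nat -> carrier S, holds e f.

Definition Th (S : structure) (f : formula) : Prop :=
  sentence f /\ satisfies S f.

Definition is_model (S : structure) (T : formula -> Prop) : Prop :=
  forall f : formula, T f -> satisfies S f.

(* For n >= 2 and x > 0, n ^ k %| x forces k < x, so the bound on k loses
   nothing; see VnP. *)
Definition Vn (n x : nat) : nat :=
  if x == 0 then 0 else \max_(k < x | n ^ k %| x) n ^ k.

Lemma VnP (n x : nat) : 1 < n -> 0 < x ->
  (exists k, Vn n x = n ^ k) /\ Vn n x %| x /\
  (forall k, n ^ k %| x -> n ^ k <= Vn n x).
Proof.
move=> n_gt1 x_gt0; rewrite /Vn -[x == 0]negbK -lt0n x_gt0 /=.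
split; last split.
- have [k _ ->] := @eq_bigmax_cond _ [pred k : 'I_x | n ^ k %| x]
    (fun k => n ^ k) (introT card_gt0P (ex_intro _ (Ordinal x_gt0) (dvd1n x))).
  by exists k.
- have [k kx ->] := @eq_bigmax_cond _ [pred k : 'I_x | n ^ k %| x]
    (fun k => n ^ k) (introT card_gt0P (ex_intro _ (Ordinal x_gt0) (dvd1n x))).
  exact: kx.
- move=> k kx; have lt_kx : k < x.
    exact: leq_trans (ltn_expl k n_gt1) (dvdn_leq x_gt0 kx).
  exact: (@leq_bigmax_cond _ _ (fun k : 'I_x => n ^ k) (Ordinal lt_kx)).
Qed.

Definition BA (n : nat) : formula -> Prop := Th (@Structure nat addn (Vn n)).

Local Open Scope ring_scope.

Definition M_pred : {pred rat * int} :=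
  [pred u | (0 <= u.1) && ((u.1 == 0) ==> (0 <= u.2))].

Lemma M_addr_closed : addr_closed M_pred.
Proof.
split=> [|[p q] [p' q']]; first by rewrite unfold_in /= lexx.
rewrite !unfold_in /= => /andP[p_ge0 /implyP Hq] /andP[p'_ge0 /implyP Hq'].
rewrite addr_ge0 //= paddr_eq0 //.
by apply/implyP=> /andP[/Hq ? /Hq' ?]; rewrite addr_ge0.
Qed.

(* The addition on M is inherited from rat * int, hence componentwise. *)
Record M : Type := MkM { M_val : rat * int; _ : M_val \in M_pred }.

HB.instance Definition _ := [isSub for M_val].
HB.instance Definition _ := [Choice of M by <:].
HB.instance Definition _ :=
  GRing.SubChoice_isSubNmodule.Build _ _ M M_addr_closed.

Lemma M_valD (x y : M) :
  M_val (x + y) = ((M_val x).1 + (M_val y).1, (M_val x).2 + (M_val y).2).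
Proof. by []. Qed.

(* Main.v *)
Require Import Defs.
From mathcomp Require Import all_boot all_order all_algebra.

Set Implicit Arguments.
Unset Strict Implicit.
Unset Printing Implicit Defensive.
Import Order.TTheory GRing.Theory Num.Theory.

(** In [N] there are arbitrarily large powers of [n]; every power of [n] that is
    at least [n ^ k] is divisible by [n ^ k]; and no power of [n] is divisible
    by [n + 1].  If [M] were a model, the first fact would yield a "power"
    [(p, q)] with [p > 0]; being above every [(0, n ^ k)], it would be
    divisible by all the standard [n ^ k], so [q = 0].  But then
    [(p, 0) = (n + 1) (p / (n + 1), 0)] is divisible by [n + 1]. *)

(* The multiplier is [k.+1], since the language has no constant [0]. *)
Definition term_mulS (k : nat) (t : term) : term := iter k (Add t) t.

Lemma eval_mulS (S : structure) (e : nat -> carrier S) (k : nat) (t : term) :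
  eval e (term_mulS k t) = iter k (add_op (eval e t)) (eval e t).
Proof. by elim: k => //= k ->. Qed.

Lemma term_vars_mulS (k i : nat) :
  term_vars (term_mulS k (Var i)) = nseq k.+1 i.
Proof. by elim: k => //= k ->. Qed.

(** [V x = x] encodes being a power of [n] or 0, and an existential summand, here variable 2,
    encodes the order. *)
Definition powers_unbounded : formula :=
  All 0 (Ex 1 (Ex 2 (And (Eq (AppV (Var 1)) (Var 1))
                         (Eq (Var 1) (Add (Var 0) (Var 2)))))).

(* [x + x <> x] expresses [x <> 0]. *)
Definition large_powers_divisible (m : nat) : formula :=
  All 0 (All 1 (All 2
    (Imp (Not (Eq (Add (Var 0) (Var 0)) (Var 0)))
    (Imp (Eq (AppV (Var 1)) (Var 1))
    (Imp (Eq (Var 1) (Add (term_mulS m (Var 0)) (Var 2)))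
         (Ex 3 (Eq (term_mulS m (Var 3)) (Var 1)))))))).

(** The conclusion is that the dividend is 0, not [Bot], because 0 is also fixed by [V]. The divisor
    is [m + 1]. *)
Definition powers_not_divisible (m : nat) : formula :=
  All 0 (All 1
    (Imp (Eq (AppV (Var 0)) (Var 0))
    (Imp (Eq (term_mulS m (Var 1)) (Var 0))
         (Eq (Add (Var 0) (Var 0)) (Var 0))))).

Lemma Vn_expn (n k : nat) : 1 < n -> Vn n (n ^ k) = n ^ k.
Proof.
move=> n_gt1; have nk_gt0 : 0 < n ^ k by rewrite expn_gt0 (ltnW n_gt1).
have [_ [dvdV leV]] := VnP n_gt1 nk_gt0.
by apply/eqP; rewrite eqn_leq (dvdn_leq nk_gt0 dvdV) leV.
Qed.

Lemma Vn_fixed (n x : nat) :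
  1 < n -> Vn n x = x -> x = 0 \/ exists k, x = n ^ k.
Proof.
move=> n_gt1 Vx; case: (posnP x) => [|x_gt0]; [by left | right].
by have [[k Vk] _] := VnP n_gt1 x_gt0; exists k; rewrite -Vk.
Qed.

Lemma BA_powers_unbounded (n : nat) : 1 < n -> BA n powers_unbounded.
Proof.
move=> n_gt1; split=> // e /= x; exists (n ^ x), (n ^ x - x) => /=.
by rewrite /update /= Vn_expn // subnKC // ltnW // ltn_expl.
Qed.

(** The predecessor offsets the shift in [term_mulS]: the multiplier is exactly [n ^ k]. *)
Lemma BA_large_powers_divisible (n k : nat) :
  1 < n -> BA n (large_powers_divisible (n ^ k).-1).
Proof.
move=> n_gt1; have nk_gt0 : 0 < n ^ k by rewrite expn_gt0 (ltnW n_gt1).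
split.
  by rewrite /sentence /= !term_vars_mulS /= ?(filter_cat, filter_nseq) /=.
move=> e /= x p z; rewrite !eval_mulS /= /update /= !iter_addn => nz_x Vp def_p.
case: (Vn_fixed n_gt1 Vp) => [-> | [j def_j]].
  by exists 0; rewrite eval_mulS /= iter_addn mul0n.
have x_gt0 : 0 < x by case: x nz_x {def_p} => [[]|].
(* Since [x >= 1], [n ^ k <= n ^ k * x <= n ^ j]. *)
have le_kj : k <= j.
  rewrite -(leq_exp2l _ _ n_gt1) -def_j def_p -mulnSr prednK //.
  by rewrite (leq_trans (leq_pmull _ x_gt0)) ?leq_addr.
exists (n ^ (j - k)); rewrite eval_mulS /= iter_addn -mulnSr prednK //.
by rewrite -expnD subnK.
Qed.

Lemma BA_powers_not_divisible (n : nat) : 1 < n -> BA n (powers_not_divisible n).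
Proof.
move=> n_gt1; split.
  by rewrite /sentence /= !term_vars_mulS /= ?(filter_cat, filter_nseq) /=.
move=> e /= p w; rewrite eval_mulS /= /update /= iter_addn -mulnSr => Vp def_p.
case: (Vn_fixed n_gt1 Vp) => [-> // | [j def_j]].
have: n.+1 %| n ^ j by rewrite -def_j -def_p dvdn_mull.
(* Divisibility makes the gcd of [n + 1] and [n ^ j] equal to [n + 1], coprimality makes it 1. *)
move/gcdn_idPl; rewrite (eqP (coprimeXr j (coprimeSn n))) => -[n0].
by rewrite -n0 in n_gt1.
Qed.

Local Open Scope ring_scope.

Lemma M_val_mulrn (x : M) (k : nat) :
  M_val (x *+ k) = ((M_val x).1 *+ k, (M_val x).2 *+ k).
Proof. by elim: k => [|k IHk] //; rewrite !mulrS M_valD IHk. Qed.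

Lemma M_mem_pos (p : rat) (q : int) : 0 < p -> (p, q) \in M_pred.
Proof. by move=> p_gt0; rewrite unfold_in /= ltW // gt_eqF. Qed.

Lemma M_val_inj (x y : M) : M_val x = M_val y -> x = y.
Proof. exact: val_inj. Qed.

Lemma M_val1_ge0 (x : M) : 0 <= (M_val x).1.
Proof. by case: x => u /= /andP[]. Qed.

Lemma expn_dvdz_eq0 (n : nat) (q : int) :
  (1 < n)%N -> (forall k, (n ^ k %| `|q|)%N) -> q = 0.
Proof.
move=> n_gt1 dvd_q; apply/eqP; rewrite -absz_eq0 -leqn0 leqNgt; apply/negP.
(* The exponent [|q|] suffices, as [n ^ |q| > |q|]. *)
move=> q_gt0; have := dvdn_leq q_gt0 (dvd_q `|q|%N).
by rewrite leqNgt ltn_expl.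
Qed.

Theorem mainTheorem5 (n : nat) (hn : (2 <= n)%N) :
  ~ exists V : M -> M, is_model (@Structure M (@GRing.add M) V) (BA n).
Proof.
case=> V modelV; pose e (_ : nat) : M := 0.
(* All multiples of [(0, 1)] lie below every element with positive first coordinate. *)
have unit_mem : (0, 1) \in M_pred by [].
pose u := MkM unit_mem.
have u_nz : u + u <> u by move/(congr1 M_val).
(* Being above [(1, 0)] forces the first coordinate of [P] to be at least 1. *)
have [P [z]] := modelV _ (BA_powers_unbounded hn) e (MkM (M_mem_pos 0 ltr01)).
rewrite /= /update /= => -[VP P_large].
have P_gt0 : 0 < (M_val P).1.
  by rewrite P_large M_valD /= (lt_le_trans ltr01) // lerDl M_val1_ge0.
have P_q0 : (M_val P).2 = 0.
  apply: (expn_dvdz_eq0 hn) => k.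
  have nk_gt0 : (0 < n ^ k)%N by rewrite expn_gt0 (ltnW hn).
  (* The difference of [P] and [n ^ k] times [u]; its second coordinate may be negative because the
     first is positive. *)
  pose r := MkM (M_mem_pos ((M_val P).2 - 1 *+ (n ^ k)%N) P_gt0).
  have := modelV _ (BA_large_powers_divisible k hn) e u P r.
  rewrite /= /update /= eval_mulS /= iter_addr -mulrSr prednK //.
  case=> // [|y].
    apply: M_val_inj; rewrite M_valD M_val_mulrn /= mul0rn add0r.
    by rewrite addrC subrK -surjective_pairing.
  rewrite eval_mulS /= iter_addr -mulrSr prednK // => <-.
  by rewrite M_val_mulrn /= -mulr_natr abszM natz dvdn_mull.
(* The rational coordinate can be divided by [n + 1], and the integer one is 0. *)
have w_gt0 : 0 < (M_val P).1 / n.+1%:R by rewrite divr_gt0 ?ltr0Sn.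
pose w := MkM (M_mem_pos 0 w_gt0).
have P_eq : w *+ n.+1 = P.
  apply: M_val_inj; rewrite M_val_mulrn /= mul0rn.
  rewrite -(mulr_natr (_ / _)) divfK ?pnatr_eq0 //.
  by rewrite -P_q0 -surjective_pairing.
have := modelV _ (BA_powers_not_divisible hn) e P w.
rewrite /= /update /= eval_mulS /= iter_addr -mulrSr => /(_ VP P_eq).
move/(congr1 (fun x => (M_val x).1)); rewrite M_valD /= => /eqP.
by rewrite -subr_eq0 addrK gt_eqF.
Qed.
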